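(* The inequality $Z(G)\le \frac34\alpha(G)$ does not hold for all connected claw-free cubic graphs of sufficiently large order; that is, for every integer $N$ there exists a connected claw-free cubic graph $G$ with at least $N$ vertices such that $Z(G)>\frac34\,\alpha(G)$.
   Context: All graphs are finite and simple. A graph is cubic if it is $3$-regular, and claw-free if it has no induced subgraph isomorphic to $K_{1,3}$. $\alpha(G)$ denotes the independence number of $G$. Zero forcing: start with a set $S\subseteq V(G)$ of colored vertices, all other vertices being uncolored. A colored vertex $v$ forces an uncolored neighbor $u$ to become colored if $u$ is the only uncolored neighbor of $v$. If iterating this rule colors all of $V(G)$, then $S$ is a zero forcing set. The zero forcing number $Z(G)$ is the minimum cardinality of a zero forcing set of $G$. *)

(* Defs.v *)
From mathcomp Require Import all_boot all_order all_algebra.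

Set Implicit Arguments.
Unset Strict Implicit.
Unset Printing Implicit Defensive.

Record sgraph := SGraph {
  vertex :> finType;
  adj : rel vertex;
  adj_sym : symmetric adj;
  adj_irrefl : irreflexive adj
}.

Definition degree (G : sgraph) (v : G) : nat := #|[set u | adj v u]|.

Definition regular (k : nat) (G : sgraph) : Prop := forall v : G, degree v = k.

Definition cubic (G : sgraph) : Prop := regular 3 G.

(* The null graph is not considered connected. *)
Definition connected (G : sgraph) : Prop :=
  0 < #|G| /\ forall x y : G, connect (@adj G) x y.

Definition isomorphic (G H : sgraph) : Prop :=
  exists2 f : G -> H, bijective f & forall x y, adj (f x) (f y) = adj x y.

Section Induced.
Variables (G : sgraph) (A : {set G}).

Definition induced_adj : rel {x : G | x \in A} :=
  fun x y => adj (val x) (val y).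

Lemma induced_sym : symmetric induced_adj.
Proof. by move=> x y; rewrite /induced_adj adj_sym. Qed.

Lemma induced_irrefl : irreflexive induced_adj.
Proof. by move=> x; rewrite /induced_adj adj_irrefl. Qed.

Definition induced : sgraph := SGraph induced_sym induced_irrefl.

End Induced.

Section CompleteBipartite.
Variables m n : nat.

Definition biclique_adj : rel ('I_m + 'I_n) :=
  fun x y => match x, y with
             | inl _, inr _ | inr _, inl _ => true
             | _, _ => false
             end.

Lemma biclique_sym : symmetric biclique_adj.
Proof. by move=> [i|i] [j|j]. Qed.

Lemma biclique_irrefl : irreflexive biclique_adj.
Proof. by move=> [i|i]. Qed.

Definition biclique : sgraph := SGraph biclique_sym biclique_irrefl.

End CompleteBipartite.

Definition claw_free (G : sgraph) : Prop :=
  forall A : {set G}, ~ isomorphic (induced A) (biclique 1 3).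

Definition independent (G : sgraph) (S : {set G}) : bool :=
  [forall x in S, forall y in S, ~~ adj x y].

Definition independence_number (G : sgraph) : nat :=
  \max_(S : {set G} | independent S) #|S|.

Definition forces (G : sgraph) (S : {set G}) (v u : G) : bool :=
  [&& v \in S, u \notin S, adj v u &
      [forall w, adj v w && (w \notin S) ==> (w == u)]].

Definition force_step (G : sgraph) : rel {set G} :=
  fun S S' => [exists v, exists u, forces S v u && (S' == u |: S)].

(* [connect] is the reflexive transitive closure: some sequence of single
   forces, starting from S, colors every vertex. *)
Definition zero_forcing (G : sgraph) (S : {set G}) : bool :=
  connect (@force_step G) S [set: G].

(* [set: G] is always zero forcing, so the minimum is attained: see
   [zero_forcingT]. *)
Definition zero_forcing_number (G : sgraph) : nat :=
  #|[arg min_(S < [set: G] | zero_forcing S) #|S|]|.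

Lemma zero_forcingT (G : sgraph) : zero_forcing [set: G].
Proof. exact: connect0. Qed.

(* Main.v *)
Require Import Defs.
From HB Require Import structures.
From mathcomp Require Import all_boot all_order all_algebra.
From mathcomp Require Import lra.

(** The graph is a ring of [n] blocks of 14 vertices, in which the independence
number is at most [5 n] and the zero forcing number at least [4 n].  A block is
a triangle [T0 Tl Tr], whose corners [Tl] and [Tr] are joined to the
neighbouring blocks, and whose corner [T0] is joined through a diamond
[U1 U2 U3 U4] to a triangle [X Y Z], which is closed up by a second diamond
[W1 W2 W3 W4].

The zero forcing number is at least the nullity of any matrix with the
off-diagonal support of the adjacency matrix: the support of a vector in the
kernel is never entered by a force from outside.  Here a kernel of dimension at
least [4 n] is cut out by 10 linear relations per block. *)

Set Implicit Arguments.
Unset Strict Implicit.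
Unset Printing Implicit Defensive.

Import GRing.Theory Num.Theory.

(** * General graphs: the nullity bound, and claws in cubic graphs *)

Lemma connect_force_zero (K : fieldType) (G : sgraph) (f : G -> K) :
  (forall S v u, forces S v u -> {in S, forall w, f w = 0%R} -> f u = 0%R) ->
  forall S S' : {set G}, connect (@force_step G) S S' ->
  {in S, forall w, f w = 0%R} -> {in S', forall w, f w = 0%R}.
Proof.
move=> fP S S' /connectP[p]; elim: p S => [|S1 p IHp] S /= => [_ -> //|].
case/andP=> /existsP[v /existsP[u /andP[Fvu /eqP->]]] pth lst f0.
apply: (IHp _ pth lst) => w; rewrite !inE => /orP[/eqP->|]; last exact: f0.
exact: fP Fvu f0.
Qed.

(** A kernel element vanishing on a zero forcing set is zero, so restriction to that set is
    injective on the kernel of [h]. By rank-nullity this kernel has dimension at least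
    [#|G| - #|C|]. *)
Lemma zero_forcing_lower_bound (K : fieldType) (G : sgraph) (C : finType)
    (h : {linear {ffun G -> K^o} -> {ffun C -> K^o}}) :
  (forall f, h f = 0%R -> forall (S : {set G}) v u, forces S v u ->
     {in S, forall w, f w = 0%R} -> f u = 0%R) ->
  #|G| <= #|C| + zero_forcing_number G.
Proof.
move=> hP; rewrite /zero_forcing_number.
case: arg_minnP => [|S ZS _]; first exact: zero_forcingT.
pose g (f : {ffun G -> K^o}) : {ffun {x | x \in S} -> K^o} :=
  [ffun x => f (val x)].
have g_lin : linear g by move=> a f1 f2; apply/ffunP=> x; rewrite !ffunE.
pose gL : {linear _ -> _} := HB.pack g (GRing.isLinear.Build _ _ _ _ g g_lin).
have dim_ffun (I : finType) (V : {vspace {ffun I -> K^o}}) : \dim V <= #|I|.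
  by have := dimvS (subvf V); rewrite dimvf /dim /= muln1.
have := limg_ker_dim (linfun h) fullv; rewrite capfv dimvf /dim /= muln1 => <-.
rewrite addnC leq_add ?dim_ffun //.
suff /limg_dim_eq <- : (lker (linfun h) :&: lker (linfun gL) = 0)%VS.
  by apply: leq_trans (dim_ffun _ _) _; rewrite card_sig.
apply/eqP; rewrite -subv0; apply/subvP=> f.
rewrite memv_cap !memv_ker !lfunE => /andP[/eqP hf /eqP gf].
rewrite memv0; apply/eqP/ffunP=> u; rewrite ffunE.
apply: (connect_force_zero (hP f hf) ZS) => // w wS.
by have /ffunP/(_ (exist _ w wS)) := gf; rewrite !ffunE.
Qed.

(** The leaves of a claw exhaust the three neighbours of its centre, two of which are adjacent. *)
Lemma cubic_claw_free (G : sgraph) :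
  cubic G ->
  (forall v : G, exists p q, [/\ adj v p, adj v q & adj p q]) -> claw_free G.
Proof.
move=> Gcubic Gtri A [f [g fK gK] f_adj].
pose v := val (g (inl ord0)); pose leaf j := val (g (inr j)).
have adjg a b : adj (val (g a)) (val (g b)) = adj a b.
  by rewrite -[RHS](congr2 (@adj _) (gK a) (gK b)) f_adj.
have leaf_inj : injective leaf by move=> i j /val_inj/(can_inj gK)[].
have leafP : [set leaf j | j : 'I_3] = [set u | adj v u].
  apply/eqP; rewrite eqEcard; apply/andP; split.
    by apply/subsetP=> _ /imsetP[j _ ->]; rewrite inE adjg.
  by have := Gcubic v; rewrite /degree => ->; rewrite card_imset // card_ord.
have [p [q [vp vq]]] := Gtri v.
have /imsetP[i _ ->]: p \in [set leaf j | j : 'I_3] by rewrite leafP inE.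
have /imsetP[j _ ->]: q \in [set leaf j | j : 'I_3] by rewrite leafP inE.
by rewrite adjg.
Qed.

(** * The ring of blocks and its independence number *)

Inductive site :=
  T0 | Tl | Tr | U1 | U2 | U3 | U4 | X | Y | Z | W1 | W2 | W3 | W4.

Definition sites := [:: T0; Tl; Tr; U1; U2; U3; U4; X; Y; Z; W1; W2; W3; W4].

Definition site_code (s : site) : nat :=
  match s with
  | T0 => 0 | Tl => 1 | Tr => 2 | U1 => 3 | U2 => 4 | U3 => 5 | U4 => 6
  | X => 7 | Y => 8 | Z => 9 | W1 => 10 | W2 => 11 | W3 => 12 | W4 => 13
  end.

Lemma site_codeK : cancel site_code (nth T0 sites). Proof. by case. Qed.

HB.instance Definition _ := Countable.copy site (can_type site_codeK).

Lemma sites_enum : Finite.axiom sites. Proof. by case. Qed.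

HB.instance Definition _ := isFinite.Build site sites_enum.

Lemma card_site : #|{: site}| = 14.
Proof. by rewrite cardT enumT unlock. Qed.

Lemma sum_site (F : site -> nat) : \sum_s F s = sumn [seq F s | s <- sites].
Proof. by rewrite /index_enum unlock /= unlock. Qed.

Section Ring.
Variable n : nat.

Definition node := ('I_n * site)%type.

(* The first two neighbours are always adjacent. *)
Definition nbrs (v : node) : seq node :=
  let: (i, s) := v in
  match s with
  | T0 => [:: (i, Tl); (i, Tr); (i, U1)]
  | Tl => [:: (i, T0); (i, Tr); (ord_pred i, Tr)]
  | Tr => [:: (i, T0); (i, Tl); (ordS i, Tl)]
  | U1 => [:: (i, U2); (i, U3); (i, T0)]
  | U2 => [:: (i, U1); (i, U3); (i, U4)]
  | U3 => [:: (i, U1); (i, U2); (i, U4)]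
  | U4 => [:: (i, U2); (i, U3); (i, X)]
  | X => [:: (i, Y); (i, Z); (i, U4)]
  | Y => [:: (i, X); (i, Z); (i, W1)]
  | Z => [:: (i, X); (i, Y); (i, W4)]
  | W1 => [:: (i, W2); (i, W3); (i, Y)]
  | W2 => [:: (i, W1); (i, W3); (i, W4)]
  | W3 => [:: (i, W1); (i, W2); (i, W4)]
  | W4 => [:: (i, W2); (i, W3); (i, Z)]
  end.

Definition ring_adj : rel node := fun u v => v \in nbrs u.

Lemma ring_sym : symmetric ring_adj.
Proof.
suff adjC u v : ring_adj u v -> ring_adj v u.
  by move=> u v; apply/idP/idP; apply: adjC.
by case: u => i [] /=; rewrite /ring_adj /= !inE => /or3P[] /eqP->;
  rewrite /= !inE ?ord_predK ?ordSK eqxx ?orbT.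
Qed.

Lemma ring_irrefl : irreflexive ring_adj.
Proof. by case=> i []; rewrite /ring_adj /= !inE !xpair_eqE /= !andbF. Qed.

Definition ring := SGraph ring_sym ring_irrefl.

Lemma card_ring : #|ring| = n * 14.
Proof. by rewrite card_prod card_ord card_site. Qed.

(** In each block the two triangles contribute at most one vertex each and the two diamonds at most
    two each. A total of six is impossible: a diamond contributes two only through its ends, and
    [U4], [W1], [W4] then exclude [X], [Y], [Z]. *)
Lemma ring_independence_number : independence_number ring <= 5 * n.
Proof.
apply/bigmax_leqP => S /forall_inP indS.
have ind u v : ring_adj u v -> ~~ ((u \in S) && (v \in S)).
  move=> uv; apply/negP=> /andP[uS vS].
  by have /forall_inP/(_ v vS) := indS u uS; rewrite /= uv.
rewrite -sum1_card big_mkcond /=.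
rewrite (eq_bigr (fun v : node => ((v.1, v.2) \in S) : nat)) => [|[i s] _];
  last by case: (_ \in S).
rewrite -(pair_bigA _ (fun i s => (((i, s) : node) \in S) : nat)) /=.
apply: (@leq_trans (\sum_(i < n) 5)); last first.
  by rewrite sum_nat_const card_ord mulnC.
apply: leq_sum => i _.
rewrite sum_site /=.
have {}ind s t : ((i, t) \in nbrs (i, s)) ==>
    ~~ (((i, s) \in S) && ((i, t) \in S)) by apply/implyP; apply: ind.
have := ind T0 Tl; have := ind T0 Tr; have := ind Tl Tr.
have := ind T0 U1; have := ind U1 U2; have := ind U1 U3; have := ind U2 U3.
have := ind U2 U4; have := ind U3 U4; have := ind U4 X.
have := ind X Y; have := ind X Z; have := ind Y Z.
have := ind Y W1; have := ind Z W4; have := ind W1 W2; have := ind W1 W3.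
have := ind W2 W3; have := ind W2 W4; have := ind W3 W4.
rewrite /= !inE !eqxx !orbT /=.
by do 14!(case: (_ \in S) => //=).
Qed.

End Ring.

(** * A large kernel, and the zero forcing number of the ring *)

Section ZeroForcing.
Variable n : nat.
Local Open Scope ring_scope.

Implicit Type f : {ffun ring n -> rat^o}.

(* For every vertex v, some combination of these relations involves every
   neighbour of v and no other vertex, except possibly v itself. *)
Definition relations f (i : 'I_n) : seq rat :=
  let x s : rat := f (i, s) in
  [:: x T0 + x Tl + x Tr; x Tr + f (ordS i, Tl);
      x T0 + x U1; x U1 + x U2 + x U3; x U2 + x U3 + x U4; x U4 + x X;
      x X - 5%:R * (x W2 + x W3); x W1 + x W4 - 2%:R * (x W2 + x W3);
      x Y + x W1 + x W2 + x W3; x Z + x W4 + x W2 + x W3].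

Definition relation_map f : {ffun 'I_n * 'I_10 -> rat^o} :=
  [ffun c => (relations f c.1)`_(c.2 : 'I_10)].

Lemma relation_map_is_linear : linear relation_map.
Proof.
move=> a f1 f2; apply/ffunP=> -[i [k k_lt]]; rewrite !ffunE /=.
do 10?[case: k k_lt => [|k] k_lt //]; rewrite /= !ffunE /GRing.scale /=; lra.
Qed.

HB.instance Definition _ :=
  GRing.isLinear.Build rat {ffun ring n -> rat^o} {ffun 'I_n * 'I_10 -> rat^o}
    _ relation_map relation_map_is_linear.

(** The least evident combinations are at the triangle [X Y Z]. With q the sum of the values at [W2]
    and [W3], the values satisfy W1 + W4 = 2q and X = 5q. Hence Y + Z + (4/5)X = 0 serves the vertex
    [X], and Z - W1 + (3/5)X = 0 serves [Y]; [Z] is symmetric to [Y]. *)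
Lemma relations_force f : relation_map f = 0 ->
  forall (S : {set ring n}) v u, forces S v u ->
  {in S, forall w, f w = 0} -> f u = 0.
Proof.
move=> /ffunP f0 S v u /and4P[vS _ vu /forallP uP] fS.
have fv := fS v vS.
have {uP} fw w : adj v w -> w != u -> f w = 0.
  move=> vw wu; apply: fS; apply: contraNT wu => wS.
  by have := uP w; rewrite vw wS.
have R j k : (k < 10)%N -> (relations f j)`_k = 0.
  by move=> k_lt; have := f0 (j, Ordinal k_lt); rewrite !ffunE.
case: v => i s in vS vu fv fw *.
(* The edge from [Tl] to the preceding block occurs in a relation of that block. *)
have := R (ord_pred i) 1 isT; rewrite /relations /= ord_predK => r.
have {R} := (R i 0 isT, R i 1 isT, R i 2 isT, R i 3 isT, R i 4 isT, R i 5 isT,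
   R i 6 isT, R i 7 isT, R i 8 isT, R i 9 isT).
rewrite /relations /= => -[[[[[[[[[r0 r1] r2] r3] r4] r5] r6] r7] r8] r9].
have {fw}: all (fun w : node n => (w == u) || ((f w : rat) == 0)) (nbrs (i, s)).
  by apply/allP=> w vw; case: eqVneq => //= wu; rewrite fw.
(* The vertex [v] and its two neighbours other than [u] have value 0, so the combination at [v]
   leaves a nonzero multiple of [f u]. *)
case: s vu fv vS => /=; rewrite /ring_adj /= !inE => /or3P[] /eqP-> fv _;
  rewrite ?eqxx ?xpair_eqE /= ?andbF ?andbT /= => /andP[/eqP e1 /eqP e2]; lra.
Qed.

Lemma ring_zero_forcing_number : (4 * n <= zero_forcing_number (ring n))%N.
Proof.
have := @zero_forcing_lower_bound _ _ _ relation_map relations_force.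
by rewrite card_ring card_prod !card_ord -leq_subLR -mulnBr mulnC.
Qed.

End ZeroForcing.

(** * Regularity, connectivity and the conclusion *)

Lemma ordS_neq n (i : 'I_n) : 1 < n -> ordS i != i.
Proof.
move=> n_gt1; apply/eqP=> /(congr1 val) /=.
have [Si_n | Si_neq] := eqVneq i.+1 n.
  by rewrite [in X in X %% _]Si_n modnn => i0; rewrite -Si_n -i0 in n_gt1.
have Si_lt : i.+1 < n by rewrite ltn_neqAle Si_neq ltn_ord.
by rewrite modn_small // => /esym/n_Sn.
Qed.

(** In a ring of one block, [Tl] and [Tr] would be listed twice as neighbours of each other. *)
Lemma uniq_nbrs n (v : node n) : 1 < n -> uniq (nbrs v).
Proof.
move=> n_gt1; case: v => i s; have iS := ordS_neq i n_gt1.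
have iP : i != ord_pred i by rewrite -{1}[i]ord_predK ordS_neq.
by case: s; rewrite /= !inE !xpair_eqE /= ?andbF //= eqxx !andbT // eq_sym.
Qed.

Lemma ring_cubic n : 1 < n -> cubic (ring n).
Proof.
move=> n_gt1 v; have /card_uniqP := uniq_nbrs v n_gt1.
by rewrite /degree cardsE => ->; case: v => i [].
Qed.

Lemma ring_claw_free n : 1 < n -> claw_free (ring n).
Proof.
move=> n_gt1; apply: cubic_claw_free (ring_cubic n_gt1) _ => -[i s].
exists (nth (i, s) (nbrs (i, s)) 0), (nth (i, s) (nbrs (i, s)) 1).
by case: s; rewrite /= /ring_adj /= !inE !eqxx ?orbT.
Qed.

(* The parent map of a spanning tree of a block, rooted at [T0]. *)
Definition parent (s : site) : site :=
  match s with
  | T0 | Tl | Tr | U1 => T0 | U2 | U3 => U1 | U4 => U2 | X => U4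
  | Y | Z => X | W1 => Y | W2 | W3 => W1 | W4 => Z
  end.

Lemma ring_connected n : connected (ring n.+1).
Proof.
split=> [|x y]; first by rewrite card_ring.
set R := @adj (ring n.+1).
have Rsym : connect_sym R by apply: sym_connect_sym; apply: ring_sym.
have block i s : connect R (i, T0) (i, s).
  (* The depth of the tree is 7, attained at [W2] and [W3]; shorter paths stay at the fixed point
     [T0]. *)
  have -> : T0 = iter 7 parent s by case: s.
  elim: 7 => [|k IHk] /=; first exact: connect0.
  apply: connect_trans IHk; move: (iter k parent s) => t.
  have [->|t_neq] := eqVneq t T0; first exact: connect0.
  apply: connect1; move: t_neq; rewrite /R /= /ring_adj.
  by case: t => //= _; rewrite !inE eqxx ?orbT.
have root i : connect R (ord0, T0) (i, T0).
  case: i => k; elim: k => [|k IHk] k_lt.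
    by rewrite (_ : Ordinal k_lt = ord0) ?connect0 //; apply: val_inj.
  have j_lt := ltnW k_lt; pose j : 'I_n.+1 := Ordinal j_lt.
  have -> : Ordinal k_lt = ordS j by apply: val_inj; rewrite /= modn_small.
  apply: connect_trans (IHk j_lt) _; apply: connect_trans (block j Tr) _.
  rewrite Rsym; apply: connect_trans (block (ordS j) Tl) _; rewrite Rsym.
  by apply: connect1; rewrite /R /= /ring_adj /= !inE eqxx !orbT.
have all0 z : connect R (ord0, T0) z.
  by case: z => i s; apply: connect_trans (root i) (block i s).
by apply: connect_trans (all0 y); rewrite Rsym.
Qed.

Theorem mainTheorem2 :
  forall N : nat, exists G : sgraph,
    [/\ connected G, claw_free G, cubic G, (N <= #|G|)%N &
        ((zero_forcing_number G)%:R
           > 3%:R / 4%:R * (independence_number G)%:R :> rat)%R].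
Proof.
(* At least two blocks make the ring cubic. *)
move=> N; exists (ring N.+2); split.
- exact: ring_connected.
- exact: ring_claw_free.
- exact: ring_cubic.
- by rewrite card_ring; apply: leq_trans (leq_pmulr _ _); rewrite // !leqW.
have := ring_zero_forcing_number N.+2; have := ring_independence_number N.+2.
rewrite -!(ler_nat rat) !natrM => hi hz.
(* Positivity makes the comparison of 4 with 15/4 per block strict. *)
have : (0 < N.+2%:R :> rat)%R by rewrite ltr0n.
lra.
Qed.
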